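(* Let $M<T$ be positive integers, $\alpha\in[0,1]$, $\kappa>0$, and $\lambda_1,\dots,\lambda_M>0$. For diagonal matrices $\hat{\bm{A}}=\mathrm{diag}(\hat a_1,\dots,\hat a_M)\succeq\bm{0}$ define $$\hat\Delta(\hat{\bm{A}})=\Big(1-\frac{M}{T}\Big)\big(M\log T-\log\det\hat{\bm{A}}\big),\qquad S(\hat{\bm{A}})=\sum_{i=1}^M\big(\lambda_i^{-1}+\kappa\hat a_i\big)^{-1},$$ and $F(\hat{\bm{A}})=\alpha\,\hat\Delta(\hat{\bm{A}})+(1-\alpha)\,S(\hat{\bm{A}})$. Then the optimization problem $$\min_{\hat{\bm{A}}}\ F(\hat{\bm{A}})\quad\text{subject to}\quad \mathrm{tr}(\hat{\bm{A}})=MT,\ \ \hat{\bm{A}}\succeq\bm{0}$$ is a convex optimization problem in $\hat{\bm{A}}$; that is, its feasible set is convex and $F$ is a convex function on it.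
   Context: $\hat{\bm{A}}=\bm{A}^2$ is the diagonal power allocation matrix; $\hat\Delta$ is the sensing-induced rate loss and $S$ the sensing error. $\hat\Delta$ is regarded as an extended-real-valued function, equal to $+\infty$ when $\det\hat{\bm{A}}=0$, with the convention $0\cdot(+\infty)=0$ (so $F=S$ when $\alpha=0$). The $\lambda_i$ are the eigenvalues of the (full-rank) sensing correlation matrix, and $\kappa=1/(\sigma_{\rm s}^2N_{\rm s})$ is a positive constant. *)

(* Defs.v *)
From HB Require Import structures.
From mathcomp Require Import all_boot all_order all_algebra.
From mathcomp Require Import all_classical all_reals all_analysis.

Set Implicit Arguments.
Unset Strict Implicit.
Unset Printing Implicit Defensive.

Import Order.TTheory GRing.Theory Num.Theory.

Local Open Scope classical_set_scope.
Local Open Scope ring_scope.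
Local Open Scope convex_scope.

Definition psdmx (R : realType) (n : nat) (A : 'M[R]_n) : Prop :=
  A^T = A /\ forall v : 'cV[R]_n, 0 <= (v^T *m A *m v) 0 0.

(* Extended-real-valued counterpart of [convex_function]; in \bar R,
   0 * +oo = 0, so that the inequality is trivial for t = 0 and t = 1. *)
Definition econvex_function (R : realType) (E : lmodType R)
    (E' := convex_lmodType E) (D : set E') (f : E' -> \bar R) : Prop :=
  forall t : {i01 R}, {in D &, forall x y : E',
    (f (x <| t |> y) <= t%:num%:E * f x + (1 - t%:num)%:E * f y)%E}.

Definition feasible_set (R : realType) (M T : nat) : set 'M[R]_M :=
  [set A | [/\ is_diag_mx A, \tr A = M%:R * T%:R & psdmx A]].

(* The natural logarithm [lne] on \bar R has [lne 0 = -oo]; since M < T, this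
   makes the rate loss +oo when \det A = 0. *)
Definition rate_loss (R : realType) (M T : nat) (A : 'M[R]_M) : \bar R :=
  ((1 - M%:R / T%:R)%:E
    * ((M%:R * ln (T%:R : R))%:E - lne (\det A)%:E))%E.

Definition sensing_error (R : realType) (M : nat) (kappa : R)
    (lambda : 'I_M -> R) (A : 'M[R]_M) : R :=
  \sum_(i < M) ((lambda i)^-1 + kappa * A i i)^-1.

Definition objective (R : realType) (M T : nat) (alpha kappa : R)
    (lambda : 'I_M -> R) (A : 'M[R]_M) : \bar R :=
  (alpha%:E * rate_loss T A
    + (1 - alpha)%:E * (sensing_error kappa lambda A)%:E)%E.

(* Minimising f over C. *)
Definition convex_problem (R : realType) (E : lmodType R)
    (E' := convex_lmodType E) (C : set E') (f : E' -> \bar R) : Prop :=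
  convex_set C /\ econvex_function C f.

(* Main.v *)
(** On the diagonal positive semidefinite matrices, [- log \det A] is the sum of
    the [- log (A i i)], extended by [+oo] at [0]; so the objective is a
    nonnegative combination of convex functions of single entries. None of
    these takes the value [-oo], hence sums and scalings behave in [\bar R]. *)
Require Import Defs.
From mathcomp Require Import all_boot all_order all_algebra.
From mathcomp Require Import all_classical all_reals all_analysis.
From mathcomp Require Import ring.
Import Order.TTheory GRing.Theory Num.Theory.
Local Open Scope ring_scope.

(** * Calculus of extended-real-valued convex functions *)

Section EconvexTheory.
Context {R : realType} {E : lmodType R}.
Local Notation E' := (convex_lmodType E).
Implicit Types (D : set E') (f g : E' -> \bar R).
Local Open Scope ereal_scope.
Local Open Scope convex_scope.

(** Convexity of [D] matters because the two functions are also compared at [x <| t |> y], which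
    must lie in [D]. *)
Lemma eq_in_econvex D f g : convex_set D -> {in D, f =1 g} ->
  econvex_function D f -> econvex_function D g.
Proof.
by move=> cD fg cf t x y xD yD; rewrite -!fg ?cf//; exact: cD.
Qed.

Lemma econvex_cst D (c : R) : econvex_function D (fun=> c%:E).
Proof.
by move=> t x y _ _; rewrite -!EFinM -EFinD -mulrDl addrC subrK mul1r.
Qed.

(** Excluding [-oo] rules out [+oo - oo], so scalars distribute over [f x + g x] and the two
    inequalities add up termwise. *)
Lemma econvexD D f g :
  {in D, forall x, -oo < f x} -> {in D, forall x, -oo < g x} ->
  econvex_function D f -> econvex_function D g ->
  econvex_function D (fun x => f x + g x).
Proof.
move=> f_gtNy g_gtNy cf cg t x y xD yD.
have D_def z : z \in D -> f z +? g z.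
  by move=> zD; rewrite ltninfty_adde_def ?inE ?f_gtNy ?g_gtNy.
rewrite !muleDr// ?D_def// addeACA.
by apply: leeD; [exact: cf|exact: cg].
Qed.

Lemma mule_gtNy (r : R) (x : \bar R) : (0 <= r)%R -> -oo < x -> -oo < r%:E * x.
Proof.
move=> r0; case: x => [u _|_|//]; first by rewrite -EFinM ltNyr.
by rewrite (lt_le_trans (ltNyr 0))// mule_ge0 ?lee_fin ?leey.
Qed.

Lemma adde_gtNy (x y : \bar R) : -oo < x -> -oo < y -> -oo < x + y.
Proof.
by case: x y => [x| |] [y| |]// _ _; [rewrite -EFinD|..]; rewrite ?ltNyr ?ltNyy.
Qed.

Lemma sume_gtNy (I : finType) (F : I -> \bar R) :
  (forall i, -oo < F i) -> -oo < \sum_i F i.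
Proof.
move=> F_gtNy; elim/big_ind : _ => //; exact: adde_gtNy.
Qed.

Lemma econvexZ D f (r : R) : (0 <= r)%R ->
  {in D, forall x, -oo < f x} ->
  econvex_function D f -> econvex_function D (fun x => r%:E * f x).
Proof.
move=> r0 f_gtNy cf t x y xD yD; rewrite 2!(muleCA _ r%:E) -muleDr//.
  by rewrite lee_wpmul2l ?lee_fin ?cf.
by rewrite ltninfty_adde_def ?inE ?mule_gtNy ?subr_ge0 ?f_gtNy.
Qed.

Lemma econvex_sum D (I : finType) (F : I -> E' -> \bar R) :
  (forall i, {in D, forall x, -oo < F i x}) ->
  (forall i, econvex_function D (F i)) ->
  econvex_function D (fun x => \sum_i F i x).
Proof.
move=> F_gtNy cF.
(* The sum is moved to the level of functions, so that induction on it can speak of convexity. *)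
have -> : (fun x => \sum_i F i x) =
    \big[(fun f g x => f x + g x)/fun=> 0]_i F i.
  by apply/funext => x; elim/big_rec2 : _ => // i u v _ ->.
(* The bound away from [-oo] is carried through the induction, since [econvexD] asks for it on both
   partial sums. *)
suff [] : econvex_function D (\big[(fun f g x => f x + g x)/fun=> 0]_i F i) /\
    {in D, forall x, -oo < (\big[(fun f g x => f x + g x)/fun=> 0]_i F i) x} by [].
elim/big_ind : _ => [|f g [cf fNy] [cg gNy]|i _]; last by split.
- by split=> [|x _]; [exact: econvex_cst|rewrite ltNyr].
- split=> [|x xD]; first exact: econvexD.
  by rewrite adde_gtNy ?fNy ?gNy.
Qed.

End EconvexTheory.

(** * Convexity of the inverse and of the negated logarithm in one variable *)

Section Scalar.
Context {R : realType}.
Implicit Types (t x y : R).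

(** The gap between the two sides is [t (1 - t) (x - y)^2 / (x y (t x + (1 - t) y))], which is
    nonnegative. *)
Lemma convex_invr t x y : 0 <= t <= 1 -> 0 < x -> 0 < y ->
  (t * x + (1 - t) * y)^-1 <= t * x^-1 + (1 - t) * y^-1.
Proof.
move=> /andP[t0 t1] x0 y0; have s0 : 0 <= 1 - t by rewrite subr_ge0.
have z0 : 0 < t * x + (1 - t) * y.
  have [->|tn0] := eqVneq t 0; first by rewrite mul0r add0r subr0 mul1r.
  by rewrite ltr_pwDl ?mulr_ge0 ?(ltW y0)// mulr_gt0// lt_neqAle eq_sym tn0.
rewrite -subr_ge0.
have -> : t * x^-1 + (1 - t) * y^-1 - (t * x + (1 - t) * y)^-1 =
    t * (1 - t) * (x - y) ^+ 2 / (x * y * (t * x + (1 - t) * y)).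
  by field; rewrite !gt_eqF.
rewrite divr_ge0 ?(ltW (mulr_gt0 (mulr_gt0 x0 y0) z0))//.
by rewrite mulr_ge0 ?sqr_ge0// mulr_ge0.
Qed.

Local Open Scope ereal_scope.

Lemma lne0 : lne 0%:E = -oo :> \bar R.
Proof. exact: le0_lneNy. Qed.

Lemma oppe_lne_gtNy x : -oo < - lne x%:E.
Proof. by rewrite /=; case: ifP => // _; rewrite ltNyr. Qed.

(** At [t = 0] and [t = 1] the convention [0 * +oo = 0] leaves an equality. Otherwise a zero
    argument makes the right side [+oo], and for positive arguments this is concavity of [ln]. *)
Lemma convex_oppe_lne t x y : (0 <= t <= 1)%R -> (0 <= x)%R -> (0 <= y)%R ->
  - lne (t * x + (1 - t) * y)%:E <=
  t%:E * (- lne x%:E) + (1 - t)%:E * (- lne y%:E).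
Proof.
move=> t01; have /andP[t0 t1] := t01.
have [->|tn0] := eqVneq t 0%R.
  by rewrite mul0e add0e mul0r add0r subr0 mul1r mul1e.
have [->|tn1] := eqVneq t 1%R.
  by rewrite subrr mul0e adde0 mul0r addr0 mul1r mul1e.
have {}t0 : (0 < t)%R by rewrite lt_neqAle eq_sym tn0.
have {}t1 : (0 < 1 - t)%R by rewrite subr_gt0 lt_neqAle tn1.
(* Ensures that a summand [+oo] on the right is not cancelled by the other one. *)
have N_gtNy (s z : R) : (0 < s)%R -> -oo < s%:E * - lne z%:E.
  by move=> s0; rewrite mule_gtNy ?oppe_lne_gtNy ?(ltW s0).
rewrite le_eqVlt => /predU1P[<- _|x0].
  by rewrite lne0 gt0_muley ?lte_fin// addye ?leey//
    gt_eqF// N_gtNy.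
rewrite le_eqVlt => /predU1P[<-|y0].
  by rewrite lne0 [X in _ + X]gt0_muley ?lte_fin// addey ?leey//
    gt_eqF// N_gtNy.
rewrite !lne_EFin ?addr_gt0 ?mulr_gt0// -!EFinN -!EFinM -EFinD lee_fin.
rewrite !mulrN -opprD lerN2.
exact: (concave_ln (Itv01 (ltW t0) (andP t01).2)).
Qed.

(** If a factor vanishes, both sides are [+oo], because [- lne] of a real is never [-oo]; otherwise
    this is [lnM]. *)
Lemma oppe_lneM x y : (0 <= x)%R -> (0 <= y)%R ->
  - lne (x * y)%:E = - lne x%:E + - lne y%:E.
Proof.
have oo z : +oo - lne z%:E = +oo by rewrite /=; case: ifP.
rewrite le_eqVlt => /predU1P[<- _|x0].
  by rewrite mul0r lne0 oo.
rewrite le_eqVlt => /predU1P[<-|y0].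
  by rewrite mulr0 lne0 addeC oo.
by rewrite !lne_EFin ?mulr_gt0// lnM// EFinD oppeD.
Qed.

Lemma oppe_lne_prod (I : finType) (F : I -> R) : (forall i, 0 <= F i)%R ->
  - lne (\prod_i F i)%:E = \sum_i - lne (F i)%:E.
Proof.
move=> F0; suff [] : (0 <= \prod_i F i)%R /\
  - lne (\prod_i F i)%:E = \sum_i - lne (F i)%:E by [].
elim/big_rec2 : _ => [|i u v _ [v0 <-]]; first by rewrite lne1 oppe0.
by rewrite mulr_ge0// oppe_lneM.
Qed.

End Scalar.

(** * The feasible set, and reduction to diagonal entries *)

Section Feasible.
Context {R : realType} (M T : nat).
Local Open Scope convex_scope.

(** Evaluate the quadratic form at the [i]-th standard basis vector. *)
Lemma psdmx_diag_ge0 (n : nat) (A : 'M[R]_n) i : psdmx A -> 0 <= A i i.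
Proof.
move=> [_ /(_ (delta_mx i 0))].
by rewrite trmx_delta -rowE -colE !mxE.
Qed.

Lemma is_diag_mx_conv (n : nat) (a b : R) (A B : 'M[R]_n) :
  is_diag_mx A -> is_diag_mx B -> is_diag_mx (a *: A + b *: B).
Proof.
move=> /is_diag_mxP dA /is_diag_mxP dB; apply/is_diag_mxP => i j ij.
by rewrite !mxE dA// dB// !mulr0 addr0.
Qed.

Lemma psdmx_conv (n : nat) (a b : R) (A B : 'M[R]_n) : 0 <= a -> 0 <= b ->
  psdmx A -> psdmx B -> psdmx (a *: A + b *: B).
Proof.
move=> a0 b0 [sA pA] [sB pB]; split=> [|v].
  by rewrite linearD/= !linearZ/= sA sB.
rewrite mulmxDr mulmxDl -!scalemxAr -!scalemxAl mxE [X in X + _]mxE.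
by rewrite [X in _ + X]mxE addr_ge0 ?mulr_ge0.
Qed.

Lemma convex_feasible_set : convex_set (@feasible_set R M T).
Proof.
move=> A B t /set_mem[dA tA pA] /set_mem[dB tB pB]; apply/mem_set.
have t1 : 0 <= 1 - t%:num by rewrite subr_ge0.
split; [exact: is_diag_mx_conv| |exact: psdmx_conv].
by rewrite linearD/= !linearZ/= tA tB -mulrDl addrC subrK mul1r.
Qed.

(** The entry [A i i] is linear in [A] and nonnegative on the feasible set, so convexity of [phi] on
    the half-line transfers to matrices. *)
Lemma econvex_diag_entry (i : 'I_M) (phi : R -> \bar R) :
  (forall t x y : R, 0 <= t <= 1 -> 0 <= x -> 0 <= y ->
    (phi (t * x + (1 - t) * y)%R
      <= t%:E * phi x + (1 - t)%:E * phi y)%E) ->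
  econvex_function (@feasible_set R M T) (fun A => phi (A i i)).
Proof.
move=> cphi t A B /set_mem[_ _ pA] /set_mem[_ _ pB].
have -> : (A <| t |> B) i i = t%:num * A i i + (1 - t%:num) * B i i.
  by rewrite !mxE.
by apply: cphi; rewrite ?psdmx_diag_ge0// ge0 le1.
Qed.

(** The determinant of a diagonal matrix is the product of its diagonal entries, here nonnegative,
    so the logarithm splits even when some entry is zero. *)
Lemma rate_lossE (A : 'M[R]_M) : feasible_set T A ->
  rate_loss T A = ((1 - M%:R / T%:R)%:E *
    ((M%:R * ln (T%:R : R))%:E + \sum_i - lne (A i i)%:E))%E.
Proof.
move=> [dA _ pA]; rewrite /rate_loss det_trig ?is_diag_mx_is_trig//.
by rewrite oppe_lne_prod// => i; exact: psdmx_diag_ge0.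
Qed.

End Feasible.

Theorem proposition3 (R : realType) (M T : nat) (alpha kappa : R)
    (lambda : 'I_M -> R)
    (hM : (0 < M)%N) (hMT : (M < T)%N)
    (halpha : 0 <= alpha <= 1) (hkappa : 0 < kappa)
    (hlambda : forall i : 'I_M, 0 < lambda i) :
  convex_problem (@feasible_set R M T) (objective T alpha kappa lambda).
Proof.
split; first exact: convex_feasible_set.
have /andP[alpha0 alpha1] := halpha.
(* The prefactor of the rate loss is nonnegative because [M < T]; scaling by it then preserves
   convexity. *)
have c0 : 0 <= 1 - M%:R / T%:R :> R.
  by rewrite subr_ge0 ler_pdivrMr ?ltr0n ?(ltn_trans hM)// mul1r ler_nat ltnW.
pose err (i : 'I_M) (x : R) := ((lambda i)^-1 + kappa * x)^-1.
(* The objective in separable form: both sums run in [\bar R] over functions of a single diagonal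
   entry, as [econvex_sum] requires. *)
pose F (A : 'M[R]_M) : \bar R :=
  (alpha%:E * ((1 - M%:R / T%:R)%:E *
      ((M%:R * ln (T%:R : R))%:E + \sum_i - lne (A i i)%:E))
    + (1 - alpha)%:E * \sum_i (err i (A i i))%:E)%E.
apply: (@eq_in_econvex _ _ _ F); first exact: convex_feasible_set.
  by move=> A /set_mem fA; rewrite /objective rate_lossE// -sumEFin.
have logdet_gtNy (A : 'M[R]_M) : (-oo < \sum_i - lne (A i i)%:E)%E.
  by apply: sume_gtNy => i; exact: oppe_lne_gtNy.
have rate_gtNy (A : 'M[R]_M) : (-oo < (1 - M%:R / T%:R)%:E *
    ((M%:R * ln (T%:R : R))%:E + \sum_i - lne (A i i)%:E))%E.
  by rewrite mule_gtNy// adde_gtNy ?ltNyr.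
have err_gtNy (A : 'M[R]_M) : (-oo < \sum_i (err i (A i i))%:E)%E.
  by apply: sume_gtNy => i; exact: ltNyr.
apply: econvexD => [A _|A _||].
- exact: mule_gtNy.
- by rewrite mule_gtNy ?subr_ge0.
- apply: econvexZ => //; apply: econvexZ => // [A _|].
    by rewrite adde_gtNy ?ltNyr.
  apply: econvexD => //; first by move=> A _; exact: ltNyr.
    exact: econvex_cst.
  apply: econvex_sum => i; first by move=> A _; exact: oppe_lne_gtNy.
  apply: (@econvex_diag_entry _ _ _ i (fun x => (- lne x%:E)%E)).
  exact: convex_oppe_lne.
- apply: econvexZ => //; first by rewrite subr_ge0.
  apply: econvex_sum => i; first by move=> A _; exact: ltNyr.
  apply: (@econvex_diag_entry _ _ _ i (fun x => (err i x)%:E))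
    => t x y t01 x0 y0.
  rewrite -!EFinM -EFinD lee_fin /err.
  (* The denominator is affine in the entry, and the weights [t] and [1 - t] sum to 1, so it
     commutes with convex combinations. *)
  have -> : (lambda i)^-1 + kappa * (t * x + (1 - t) * y) =
      t * ((lambda i)^-1 + kappa * x) + (1 - t) * ((lambda i)^-1 + kappa * y).
    by ring.
  by apply: convex_invr; rewrite // ltr_wpDr ?invr_gt0 ?mulr_ge0 ?(ltW hkappa).
Qed.
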